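(* Let $(x,\mu,\lambda)\in\mathbb{R}^n\times\mathbb{R}^m\times\mathcal{E}$ be a KKT triple of the nonlinear symmetric cone problem (P1): minimize $f(x)$ subject to $h(x)=0$, $g(x)\in\mathcal{K}$. Suppose that $$\langle\nabla_x^2L(x,\mu,\lambda)v,v\rangle+2\langle w\circ w,\lambda\rangle>0$$ for every nonzero $(v,w)\in\mathbb{R}^n\times\mathcal{E}$ such that $Jg(x)v-2\sqrt{g(x)}\circ w=0$ and $Jh(x)v=0$. Then $x$ is a local minimum of (P1), $\lambda\in\mathcal{K}$, and strict complementarity is satisfied, i.e. $\operatorname{rank} g(x)+\operatorname{rank}\lambda=r$.
   Context: $(\mathcal{E},\circ)$ is a Euclidean Jordan algebra: a finite-dimensional real inner product space with a bilinear product $\circ$ and unit $e$ such that $y\circ z=z\circ y$, $y\circ(y^2\circ z)=y^2\circ(y\circ z)$ (with $y^2=y\circ y$) and $\langle y\circ z,w\rangle=\langle y,z\circ w\rangle$. Every $y\in\mathcal{E}$ has a spectral decomposition $y=\sum_{i=1}^r\sigma_ic_i$ with real eigenvalues $\sigma_i$ (unique up to order) and a Jordan frame $c_1,\dots,c_r$ (primitive idempotents with $c_i\circ c_j=0$ for $i\neq j$ and $\sum_ic_i=e$). $r$ depends only on $\mathcal{E}$ and is its rank; the rank of $y$ is its number of nonzero eigenvalues; $\operatorname{tr}(y)=\sum_i\sigma_i$, and $\langle x,y\rangle=\operatorname{tr}(x\circ y)$. $\mathcal{K}=\{y\circ y\mid y\in\mathcal{E}\}$ is the cone of squares (elements with nonnegative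 eigenvalues); for $y\in\mathcal{K}$, $\sqrt{y}=\sum_i\sqrt{\sigma_i}\,c_i$. $f:\mathbb{R}^n\to\mathbb{R}$, $h:\mathbb{R}^n\to\mathbb{R}^m$, $g:\mathbb{R}^n\to\mathcal{E}$ are twice continuously differentiable; $Jh,Jg$ are the Jacobians (derivatives), $^*$ denotes adjoint. The Lagrangian of (P1) is $L(x,\mu,\lambda)=f(x)-\langle h(x),\mu\rangle-\langle g(x),\lambda\rangle$. A KKT triple $(x,\mu,\lambda)$ of (P1) satisfies $\nabla f(x)-Jh(x)^*\mu-Jg(x)^*\lambda=0$, $\lambda\in\mathcal{K}$, $g(x)\in\mathcal{K}$, $\lambda\circ g(x)=0$, $h(x)=0$. *)

(* Defs.v *)
From HB Require Import structures.
From mathcomp Require Import all_boot all_order all_algebra.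
From mathcomp Require Import all_classical all_reals all_analysis.
From mathcomp Require Import sesquilinear.

Set Implicit Arguments.
Unset Strict Implicit.
Unset Printing Implicit Defensive.

Import Order.TTheory GRing.Theory Num.Theory.
Import numFieldNormedType.Exports.

Local Open Scope classical_set_scope.
Local Open Scope ring_scope.

Reserved Notation "x ∘ y" (at level 40, left associativity).

(** Finite dimension comes from [Vector]; [jnormE] ties the norm, hence the
    topology used for derivatives, to the inner product [jdot]. *)
HB.mixin Record isEuclideanJordan (R : realType) (E : Type)
    of NormedModule R E & Vector R E := {
  jmul : {bilinear E -> E -> E};
  jone : E;
  jdot : {dot E for (@idfun R)};
  jnormE : forall y : E, `|y| = Num.sqrt (jdot y y);
  jmulC : forall y z : E, jmul y z = jmul z y;
  jmul1 : forall y : E, jmul jone y = y;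
  jordan_identity : forall y z : E,
    jmul y (jmul (jmul y y) z) = jmul (jmul y y) (jmul y z);
  jdot_assoc : forall y z w : E, jdot (jmul y z) w = jdot y (jmul z w)
}.

#[short(type="euclideanJordanType")]
HB.structure Definition EuclideanJordan (R : realType) :=
  {E of NormedModule R E & Vector R E & isEuclideanJordan R E}.

Notation "x ∘ y" := (jmul x y) : ring_scope.

Section JordanAlgebra.
Context {R : realType} {E : euclideanJordanType R}.
Implicit Types (y z c : E).

Definition jidempotent c := c ∘ c = c.

Definition jprimitive c := [/\ jidempotent c, c != 0 &
  forall a b : E, jidempotent a -> jidempotent b -> a ∘ b = 0 -> c = a + b ->
    a = 0 \/ b = 0].

Definition jordan_frame (r : nat) (c : 'I_r -> E) := [/\
  forall i, jprimitive (c i),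
  forall i j, i != j -> c i ∘ c j = 0 &
  \sum_i c i = jone].

Definition spectral_decomposition y (r : nat) (s : 'I_r -> R) (c : 'I_r -> E) :=
  jordan_frame c /\ y = \sum_i s i *: c i.

(** By the spectral theorem, the sets in the next three definitions are
    singletons: a decomposition of [y] exists, its coefficients are unique up
    to order, and so is the sum of the [c i] sharing a given coefficient. *)
Definition jtr y : R := xget 0 [set t | exists (r : nat) s (c : 'I_r -> E),
  spectral_decomposition y s c /\ t = \sum_i s i].

Definition jrank y : nat := xget 0%N [set k | exists (r : nat) s (c : 'I_r -> E),
  spectral_decomposition y s c /\ k = #|[pred i | s i != 0]|].

(** Meaningful for [y] in the cone of squares, where all the [s i] are
    nonnegative. *)
Definition jsqrt y : E := xget 0 [set z | exists (r : nat) s (c : 'I_r -> E),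
  spectral_decomposition y s c /\ z = \sum_i Num.sqrt (s i) *: c i].

Definition cone_of_squares : set E := [set y ∘ y | y in setT].

End JordanAlgebra.

(** Well defined because all Jordan frames of [E] have the same size. *)
Definition algebra_rank (R : realType) (E : euclideanJordanType R) : nat :=
  xget 0%N [set r | exists c : 'I_r -> E, jordan_frame c].

Definition dotr (R : realType) (n : nat) (u v : 'rV[R]_n) : R :=
  \sum_i u 0 i * v 0 i.

Section Calculus.
Context {R : realType} {n : nat}.

(** In finite dimension, the continuity and differentiability of the derivative
    [x |-> 'd F x] amount to those of [x |-> 'd F x v] for all [v]. The norm of
    ['rV[R]_n] is the sup norm, equivalent to the Euclidean one. *)
Definition C1 (W : normedModType R) (F : 'rV[R]_n -> W) :=
  (forall x, differentiable F x) /\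
  (forall v, continuous (fun x => 'd F x v)).

Definition C2 (W : normedModType R) (F : 'rV[R]_n -> W) :=
  (forall x, differentiable F x) /\
  (forall v, C1 (fun x => 'd F x v : W)).

(** The adjoint of a linear map [A : R^n -> W] for a bilinear form [dot] on
    [W], characterized by [adjointP]. *)
Definition adjoint (W : Type) (dot : W -> W -> R) (A : 'rV[R]_n -> W) (w : W)
  : 'rV[R]_n := \row_i dot (A 'e_i) w.

Lemma adjointP (W : lmodType R) (dot : W -> W -> R) (A : {linear 'rV[R]_n -> W})
    (w : W) : linear_for *%R (dot^~ w) ->
  forall v, dot (A v) w = dotr v (adjoint dot A w).
Proof.
move=> dotl v; pose D := GRing.isLinear.Build R W R *%R (dot^~ w) dotl.
pose dw : {linear W -> R | *%R} := HB.pack (dot^~ w) D.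
rewrite -[LHS]/(dw (A v)) {1}(row_sum_delta v) !linear_sum.
by apply: eq_bigr => i _; rewrite !linearZ /= mxE.
Qed.

Definition gradient (F : 'rV[R]_n -> R) (x : 'rV[R]_n) : 'rV[R]_n :=
  \row_i 'd F x 'e_i.

Lemma gradientP (F : 'rV[R]_n -> R) (x v : 'rV[R]_n) :
  'd F x v = dotr (gradient F x) v.
Proof.
rewrite {1}(row_sum_delta v) linear_sum; apply: eq_bigr => i _.
by rewrite linearZ /= mxE mulrC.
Qed.

Definition hessian (F : 'rV[R]_n -> R) (x v : 'rV[R]_n) : 'rV[R]_n :=
  'd (gradient F) x v.

End Calculus.

Section NonlinearSymmetricConeProgram.
Context {R : realType} {n m : nat} {E : euclideanJordanType R}.
Variables (f : 'rV[R]_n -> R) (h : 'rV[R]_n -> 'rV[R]_m) (g : 'rV[R]_n -> E).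

Definition feasible (x : 'rV[R]_n) := h x = 0 /\ cone_of_squares (g x).

Definition local_minimum (x : 'rV[R]_n) :=
  feasible x /\ \forall z \near x, feasible z -> f x <= f z.

Definition lagrangian (mu : 'rV[R]_m) (la : E) (x : 'rV[R]_n) : R :=
  f x - dotr (h x) mu - jdot (g x) la.

Definition KKT (x : 'rV[R]_n) (mu : 'rV[R]_m) (la : E) :=
  [/\ gradient f x - adjoint (@dotr R m) ('d h x) mu
        - adjoint jdot ('d g x) la = 0,
      cone_of_squares la, cone_of_squares (g x), la ∘ g x = 0 & h x = 0].

End NonlinearSymmetricConeProgram.

(* Main.v *)
Require Import Defs.
From HB Require Import structures.
From mathcomp Require Import all_boot all_order all_algebra.
From mathcomp Require Import all_classical all_reals all_analysis.
From mathcomp Require Import sesquilinear ring lra.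

(** Since [jdot z z = jtr (z ∘ z)] is nonzero for [z != 0], the trace of a
    nonzero square is not the default value [0] of [xget], so squares, and then
    by a shift along the unit all elements, have spectral decompositions.
    Primitive idempotents have norm [1], so every Jordan frame has [jdot e e]
    elements.

    Strict complementarity: if [p] and [q] are the support idempotents of [g x]
    and [la], then [c = e - p - q] is an idempotent annihilated by both, so that
    the direction [(0, c)] contradicts the second-order condition unless [c = 0].

    Local minimality: writing [g z] as the square of a slack variable turns the
    assumption into the second-order sufficient condition of an
    equality-constrained problem. A feasible [z] close to [x] is lifted to its
    slack [jsqrt (g z)], which is close to [jsqrt (g x)] because
    [|a - b|^2 <= r |a ∘ a - b ∘ b|] on the cone; Finsler's lemma and a
    second-order Taylor expansion of the Lagrangian conclude. *)

Set Implicit Arguments.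
Unset Strict Implicit.
Unset Printing Implicit Defensive.
Import Order.TTheory GRing.Theory Num.Theory.
Import numFieldNormedType.Exports.
Local Open Scope classical_set_scope.
Local Open Scope ring_scope.

(** * Euclidean Jordan algebras *)

Section JordanTheory.
Context {R : realType} {E : euclideanJordanType R}.
Implicit Types a b c p q y z w : E.

Lemma jdotC a b : jdot a b = jdot b a.
Proof. by rewrite hermC expr0 mul1r. Qed.

Lemma jdotDr a b c : jdot a (b + c) = jdot a b + jdot a c.
Proof. by rewrite linearDr. Qed.

Lemma jdotDl a b c : jdot (a + b) c = jdot a c + jdot b c.
Proof. by rewrite linearDl. Qed.

Lemma jdotBr a b c : jdot a (b - c) = jdot a b - jdot a c.
Proof. by rewrite linearBr. Qed.

Lemma jdotBl a b c : jdot (a - b) c = jdot a c - jdot b c.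
Proof. by rewrite linearBl. Qed.

Lemma jdotNl a b : jdot (- a) b = - jdot a b.
Proof. by rewrite linearNl. Qed.

Lemma jdotZl t a b : jdot (t *: a) b = t * jdot a b.
Proof. by rewrite linearZl_LR. Qed.

Lemma jdotZr t a b : jdot a (t *: b) = t * jdot a b.
Proof. by rewrite linearZr. Qed.

Lemma jdot0l a : jdot 0 a = 0.
Proof. by rewrite linear0l. Qed.

Lemma jdot0r a : jdot a 0 = 0.
Proof. by rewrite linear0r. Qed.

Lemma jdot_suml (I : finType) (P : pred I) (F : I -> E) a :
  jdot (\sum_(i | P i) F i) a = \sum_(i | P i) jdot (F i) a.
Proof. by rewrite linear_sumlz. Qed.

Lemma jdot_sumr (I : finType) (P : pred I) (F : I -> E) a :
  jdot a (\sum_(i | P i) F i) = \sum_(i | P i) jdot a (F i).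
Proof. by rewrite linear_sumr. Qed.

Lemma jdot_gt0 a : a != 0 -> 0 < jdot a a.
Proof. by move=> a0; rewrite neq0_dnorm_gt0. Qed.

Lemma jdot_ge0 a : 0 <= jdot a a.
Proof. by have [->|/jdot_gt0/ltW//] := eqVneq a 0; rewrite jdot0l. Qed.

Lemma jdot_eq0 a : jdot a a = 0 -> a = 0.
Proof. by move=> a0; apply: contra_eq a0 => /jdot_gt0; rewrite lt0r => /andP[]. Qed.

Lemma jnorm_sqr a : `|a| ^+ 2 = jdot a a.
Proof. by rewrite jnormE sqr_sqrtr// jdot_ge0. Qed.

(** Cauchy-Schwarz: the squared norm of [jdot b b *: a - jdot a b *: b] is [jdot b b] times the
    defect of the squared inequality. *)
Lemma jdot_le_norm a b : `|jdot a b| <= `|a| * `|b|.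
Proof.
have [->|b0] := eqVneq b 0; first by rewrite jdot0r normr0 mulr_ge0.
rewrite -ler_sqr ?nnegrE ?mulr_ge0// real_normK ?num_real// exprMn !jnorm_sqr.
have := jdot_ge0 (jdot b b *: a - jdot a b *: b).
rewrite !(jdotBl, jdotBr, jdotZl, jdotZr) (jdotC b a) => ab.
rewrite -(ler_pM2l (jdot_gt0 b0)); lra.
Qed.

Lemma jmulDl a b c : (a + b) ∘ c = a ∘ c + b ∘ c.
Proof. by rewrite linearDl. Qed.

Lemma jmulDr a b c : a ∘ (b + c) = a ∘ b + a ∘ c.
Proof. by rewrite linearDr. Qed.

Lemma jmulNl a b : (- a) ∘ b = - (a ∘ b).
Proof. by rewrite linearNl. Qed.

Lemma jmulNr a b : a ∘ (- b) = - (a ∘ b).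
Proof. by rewrite linearNr. Qed.

Lemma jmulZl t a b : (t *: a) ∘ b = t *: (a ∘ b).
Proof. by rewrite linearZl_LR. Qed.

Lemma jmulZr t a b : a ∘ (t *: b) = t *: (a ∘ b).
Proof. by rewrite linearZr_LR. Qed.

Lemma jmul0l a : 0 ∘ a = 0.
Proof. by rewrite linear0l. Qed.

Lemma jmul0r a : a ∘ 0 = 0.
Proof. by rewrite linear0r. Qed.

Lemma jmul_suml (I : finType) (P : pred I) (F : I -> E) a :
  (\sum_(i | P i) F i) ∘ a = \sum_(i | P i) F i ∘ a.
Proof. by rewrite linear_sumlz. Qed.

Lemma jmul_sumr (I : finType) (P : pred I) (F : I -> E) a :
  a ∘ (\sum_(i | P i) F i) = \sum_(i | P i) a ∘ F i.
Proof. by rewrite linear_sumr. Qed.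

Lemma jmulr1 a : a ∘ jone = a.
Proof. by rewrite jmulC jmul1. Qed.

Lemma jdot_mulr a b c : jdot a (b ∘ c) = jdot (b ∘ a) c.
Proof. by rewrite [b ∘ a]jmulC jdot_assoc. Qed.

(* Odd part in [t] of the Jordan identity for [q + t z], evaluated at [q]. *)
Lemma idempotent_mul_poly q z : jidempotent q ->
  2 *: (q ∘ (q ∘ (q ∘ z))) + q ∘ z = 3 *: (q ∘ (q ∘ z)).
Proof.
move=> qq; apply/eqP; rewrite -subr_eq0; apply/eqP.
suff H u : jdot (2 *: (q ∘ (q ∘ (q ∘ z))) + q ∘ z - 3 *: (q ∘ (q ∘ z))) u = 0.
  exact/jdot_eq0/H.
have := congr1 (jdot^~ u) (jordan_identity (q + z) q).
have := congr1 (jdot^~ u) (jordan_identity (q - z) q).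
have := congr1 (jdot^~ u) (jordan_identity z q).
rewrite !(jmulDl, jmulDr, jmulNl, jmulNr) !opprK !qq !(jmulC z q).
rewrite !(jmulC (q ∘ z) q) !(jmulC (z ∘ z) q).
rewrite !(jdotDl, jdotBl, jdotNl, jdotZl).
lra.
Qed.

(* The multiplication [L] by [q] satisfies [2 L^3 - 3 L^2 + L = 0], hence
   [L = L^2 + 4 (L - L^2)^2], a sum of squares. *)
Lemma idempotent_jdotE q z : jidempotent q -> jdot z (q ∘ z) =
  jdot (q ∘ z) (q ∘ z)
  + 4 * jdot (q ∘ z - q ∘ (q ∘ z)) (q ∘ z - q ∘ (q ∘ z)).
Proof.
move=> qq.
have := congr1 (jdot z) (idempotent_mul_poly z qq).
have := congr1 (jdot z) (idempotent_mul_poly (q ∘ z) qq).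
rewrite !(jdotBl, jdotBr, jdotDr, jdotZr) -!jdot_mulr.
lra.
Qed.

Lemma idempotent_jdot_ge0 q z : jidempotent q -> 0 <= jdot z (q ∘ z).
Proof. by move=> qq; rewrite idempotent_jdotE// addr_ge0// ?mulr_ge0// jdot_ge0. Qed.

Lemma idempotent_jdot_eq0 q z : jidempotent q -> jdot z (q ∘ z) = 0 -> q ∘ z = 0.
Proof.
move=> qq; rewrite idempotent_jdotE// => /eqP.
by rewrite paddr_eq0 ?mulr_ge0// ?jdot_ge0// => /andP[/eqP/jdot_eq0].
Qed.

Lemma jidempotent_cone q : jidempotent q -> cone_of_squares q.
Proof. by move=> qq; exists q. Qed.

Lemma cone_idempotent_jdot_ge0 y q :
  cone_of_squares y -> jidempotent q -> 0 <= jdot y q.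
Proof.
by move=> [z _ <-] qq; rewrite jdot_assoc [z ∘ q]jmulC idempotent_jdot_ge0.
Qed.

(** Since [p = p ∘ p], the inner product of [p] and [q] is the quadratic form of multiplication by
    [q] at [p], and this form vanishes only on the kernel. *)
Lemma idempotent_orth p q : jidempotent p -> jidempotent q ->
  jdot p q = 0 -> p ∘ q = 0.
Proof.
move=> pp qq pq; rewrite jmulC; apply: idempotent_jdot_eq0 => //.
by rewrite [q ∘ p]jmulC -jdot_assoc pp.
Qed.

(** * Calculus in a Jordan frame *)

Section Frame.
Variables (r : nat) (c : 'I_r -> E).
Hypothesis cF : jordan_frame c.

Lemma frame_idempotent i : jidempotent (c i).
Proof. by case: cF => /(_ i)[]. Qed.

Lemma frame_scaleI i : injective ( *:%R^~ (c i)).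
Proof.
move=> s t /eqP; rewrite -subr_eq0 -scalerBl scaler_eq0 subr_eq0.
by case: cF => /(_ i)[_ /negPf-> _] _ _; rewrite orbF => /eqP.
Qed.

Lemma frame_mul i j : c i ∘ c j = if i == j then c i else 0.
Proof.
by case: (cF) => _ co _; case: eqVneq => [->|/co//]; exact: frame_idempotent.
Qed.

Lemma frame_mul_sum (s : 'I_r -> R) i : (\sum_j s j *: c j) ∘ c i = s i *: c i.
Proof.
rewrite jmul_suml (bigD1 i)//= big1 ?addr0 => [|j ji].
  by rewrite jmulZl frame_mul eqxx.
by rewrite jmulZl frame_mul (negPf ji) scaler0.
Qed.

Lemma frame_sum_mul (s t : 'I_r -> R) :
  (\sum_j s j *: c j) ∘ (\sum_j t j *: c j) = \sum_j (s j * t j) *: c j.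
Proof.
rewrite jmul_sumr; apply: eq_bigr => i _.
by rewrite jmulZr frame_mul_sum scalerA mulrC.
Qed.

Lemma frame_sum_pred (P : pred 'I_r) :
  \sum_(i | P i) c i = \sum_i (P i)%:R *: c i.
Proof.
by rewrite big_mkcond; apply: eq_bigr => i _; case: (P i); rewrite ?scale1r ?scale0r.
Qed.

Lemma frame_pred_idempotent (P : pred 'I_r) : jidempotent (\sum_(i | P i) c i).
Proof.
rewrite frame_sum_pred /jidempotent frame_sum_mul; apply: eq_bigr => i _.
by case: (P i); rewrite ?mulr1 ?mulr0.
Qed.

End Frame.

(** * Spectral decompositions, square roots and ranks *)

Section Trace.
Hypothesis jdotE : forall y z, jdot y z = jtr (y ∘ z).

Lemma jtr_neq0 y : jtr y != 0 -> exists r s (c : 'I_r -> E),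
  spectral_decomposition y s c /\ jtr y = \sum_i s i.
Proof.
pose S : set R := [set t | exists (r : nat) s (c : 'I_r -> E),
  spectral_decomposition y s c /\ t = \sum_i s i].
move=> y0; have [/(xgetPex 0)//|nex] := pselect (exists t, S t).
by move: y0; rewrite /jtr xgetPN ?eqxx// => t tE; apply: nex; exists t.
Qed.

Lemma spectral_exists y : exists r s (c : 'I_r -> E), spectral_decomposition y s c.
Proof.
(* If the unit is zero, so is the whole algebra, and the empty frame serves. *)
have [e0|e_neq0] := eqVneq (jone : E) 0.
  exists 0%N, (fun=> 0), (fun=> 0); split; last first.
    by rewrite big_ord0 -[y]jmul1 e0 jmul0l.
  by split=> [[]//|[]//|]; rewrite big_ord0 e0.
(* This shift gives [y + t *: jone] trace [1], so it has a decomposition; subtracting [t] from its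
   coefficients gives one of [y]. *)
pose t := (1 - jdot y jone) / jdot (jone : E) jone.
have ee : jdot (jone : E) jone != 0 by rewrite gt_eqF// jdot_gt0.
have /jtr_neq0[r [s [c [[cF yE] _]]]] : jtr (y + t *: jone) != 0.
  rewrite -[_ + _]jmulr1 -jdotE jdotDl jdotZl divfK// addrC subrK.
  exact: oner_neq0.
exists r, (fun i => s i - t), c; split=> //.
case: (cF) => _ _ c1; rewrite -(addrK (t *: jone) y) yE -c1 scaler_sumr -sumrB.
by apply: eq_bigr => i _; rewrite scalerBl.
Qed.

(** Idempotence forces every coefficient of [p] to be [0] or [1]. If [s i = 1], primitivity applied
    to [p = c i + (p - c i)] yields [p = c i], whose only nonzero coefficient is [s i]. *)
Lemma primitive_jdot p : jprimitive p -> jdot p p = 1.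
Proof.
move=> [pp p0 pP]; have : jdot p p != 0 by rewrite gt_eqF// jdot_gt0.
rewrite jdotE pp => /jtr_neq0[r [s [c [[cF pE] ->]]]].
have pc i : p ∘ c i = s i *: c i by rewrite pE (frame_mul_sum cF).
have c0 i : c i != 0 by case: cF => /(_ i)[].
have ss i : s i * s i = s i.
  have : p ∘ c i = (s i * s i) *: c i.
    by rewrite -[in LHS]pp {1 2}pE (frame_sum_mul cF) (frame_mul_sum cF).
  by rewrite pc => /esym/(frame_scaleI cF).
have [i si0] : exists i, s i != 0.
  apply/existsP; apply: contraNT p0; rewrite negb_exists => /forallP s0.
  by rewrite pE big1// => i _; rewrite (eqP (negPn (s0 i))) scale0r.
have si1 : s i = 1 by apply: (mulfI si0); rewrite ss mulr1.
have pci : p ∘ c i = c i by rewrite pc si1 scale1r.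
have ci := frame_idempotent cF i.
have pB : c i = p.
  have [] := pP (c i) (p - c i) ci.
  - rewrite /jidempotent !(jmulDl, jmulDr, jmulNl, jmulNr) pp.
    by rewrite [c i ∘ p]jmulC pci ci opprK addNr addr0.
  - by rewrite jmulDr jmulNr ci jmulC pci subrr.
  - by rewrite addrC subrK.
  - by move=> /eqP; rewrite (negPf (c0 i)).
  - by move/subr0_eq.
rewrite (bigD1 i)//= si1 big1 ?addr0// => j ji; apply: (@frame_scaleI _ _ cF j).
by rewrite -pc -pB (frame_mul cF) eq_sym (negPf ji) scale0r.
Qed.

Section FrameTrace.
Variables (r : nat) (c : 'I_r -> E).
Hypothesis cF : jordan_frame c.

Lemma frame_jdot i j : jdot (c i) (c j) = (i == j)%:R.
Proof.
have [<-|ij] := eqVneq i j; first by apply: primitive_jdot; case: cF.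
by rewrite -(frame_idempotent cF i) jdot_assoc (frame_mul cF) (negPf ij) jdot0r.
Qed.

Lemma frame_jdot_sum (s : 'I_r -> R) i : jdot (\sum_j s j *: c j) (c i) = s i.
Proof.
rewrite jdot_suml (bigD1 i)//= big1 ?addr0 => [|j ji].
  by rewrite jdotZl frame_jdot eqxx mulr1.
by rewrite jdotZl frame_jdot (negPf ji) mulr0.
Qed.

Lemma frame_jdot_sqr (s : 'I_r -> R) :
  jdot (\sum_j s j *: c j) (\sum_j s j *: c j) = \sum_j s j ^+ 2.
Proof.
rewrite jdot_sumr; apply: eq_bigr => i _.
by rewrite jdotZr frame_jdot_sum expr2.
Qed.

Lemma frame_pred_jdot (P : pred 'I_r) : jdot (\sum_(i | P i) c i) jone = #|P|%:R.
Proof.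
rewrite jdot_suml -sum1_card natr_sum; apply: eq_bigr => i _.
by rewrite -{1}(frame_idempotent cF i) jdot_assoc jmulr1 frame_jdot eqxx.
Qed.

Lemma frame_size : jdot (jone : E) jone = r%:R.
Proof. by case: (cF) => _ _ {1}<-; rewrite frame_pred_jdot card_ord. Qed.

Lemma frame_jdot_le i y : `|jdot (c i) y| <= `|y|.
Proof.
by rewrite (le_trans (jdot_le_norm _ _))// jnormE frame_jdot eqxx sqrtr1 mul1r.
Qed.

End FrameTrace.

Lemma jdot_jone_rank : jdot (jone : E) jone = (algebra_rank E)%:R.
Proof.
have [r [s [c [cF _]]]] := spectral_exists 0.
rewrite /algebra_rank; case: xgetP => [k _ [d dF]|/(_ r)[]]; last by exists c.
exact: frame_size dF.
Qed.

(** The coefficient [s i] is the inner product of [y] with the idempotent [c i]. *)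
Lemma cone_spectral_ge0 y r s (c : 'I_r -> E) i :
  cone_of_squares y -> spectral_decomposition y s c -> 0 <= s i.
Proof.
move=> yK [cF yE]; rewrite -(frame_jdot_sum cF s i) -yE.
exact/cone_idempotent_jdot_ge0/(frame_idempotent cF).
Qed.

(** Expanding [b] writes [jdot a b] as a sum of nonnegative terms, all of which must vanish. *)
Lemma cone_orth_frame a b r s (c : 'I_r -> E) i :
  cone_of_squares a -> cone_of_squares b -> jdot a b = 0 ->
  spectral_decomposition b s c -> s i != 0 -> jdot a (c i) = 0.
Proof.
move=> aK bK ab bsc si0; have [cF bE] := bsc.
move: ab; rewrite bE jdot_sumr => /psumr_eq0P.
have H j : true -> 0 <= jdot a (s j *: c j).
  move=> _; rewrite jdotZr mulr_ge0 ?(cone_spectral_ge0 j bK bsc)//.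
  exact/cone_idempotent_jdot_ge0/(frame_idempotent cF).
move=> /(_ H i isT); rewrite jdotZr => /eqP.
by rewrite mulf_eq0 (negPf si0) => /eqP.
Qed.

(** The previous lemma is used twice: it makes [a] orthogonal to [d j], and then [d j], itself in
    the cone, orthogonal to [c i]. *)
Lemma cone_orth_frames a b r s (c : 'I_r -> E) k t (d : 'I_k -> E) i j :
  cone_of_squares a -> cone_of_squares b -> jdot a b = 0 ->
  spectral_decomposition a s c -> spectral_decomposition b t d ->
  s i != 0 -> t j != 0 -> c i ∘ d j = 0.
Proof.
move=> aK bK ab asc btd si0 tj0; have [[cF _] [dF _]] := (asc, btd).
have ci := frame_idempotent cF i; have dj := frame_idempotent dF j.
have adj := cone_orth_frame aK bK ab btd tj0.
rewrite jmulC; apply: idempotent_orth => //.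
apply: (cone_orth_frame _ _ _ asc si0) => //; first exact: jidempotent_cone.
by rewrite jdotC.
Qed.

Lemma jsqrt_spectral y : exists r s (c : 'I_r -> E),
  spectral_decomposition y s c /\ jsqrt y = \sum_i Num.sqrt (s i) *: c i.
Proof.
have [r [s [c ysc]]] := spectral_exists y.
rewrite /jsqrt; case: xgetP => [z _ [k [t [d [ytd zE]]]]|].
  by exists k, t, d.
by move=> /(_ (\sum_i Num.sqrt (s i) *: c i))[]; exists r, s, c.
Qed.

Lemma jrank_spectral y : exists r s (c : 'I_r -> E),
  spectral_decomposition y s c /\ jrank y = #|[pred i | s i != 0]|.
Proof.
have [r [s [c ysc]]] := spectral_exists y.
rewrite /jrank; case: xgetP => [z _ [k [t [d [ytd zE]]]]|].
  by exists k, t, d.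
by move=> /(_ #|[pred i | s i != 0]|)[]; exists r, s, c.
Qed.

Lemma jsqrtK y : cone_of_squares y -> jsqrt y ∘ jsqrt y = y.
Proof.
move=> yK; have [r [s [c [ysc ->]]]] := jsqrt_spectral y; have [cF yE] := ysc.
rewrite (frame_sum_mul cF) [RHS]yE; apply: eq_bigr => i _.
by rewrite -expr2 sqr_sqrtr// (cone_spectral_ge0 i yK ysc).
Qed.

Lemma jsqrt_cone y : cone_of_squares (jsqrt y).
Proof.
have [r [s [c [[cF _] ->]]]] := jsqrt_spectral y.
exists (\sum_i Num.sqrt (Num.sqrt (s i)) *: c i) => //.
rewrite (frame_sum_mul cF); apply: eq_bigr => i _.
by rewrite -expr2 sqr_sqrtr// sqrtr_ge0.
Qed.

(** A zero coefficient of [a] stays zero under the root, so only frame elements that annihilate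
    those of [b] contribute. *)
Lemma jsqrt_orth a b : cone_of_squares a -> cone_of_squares b ->
  jdot a b = 0 -> jsqrt a ∘ b = 0.
Proof.
move=> aK bK ab; have [r [s [c [asc ->]]]] := jsqrt_spectral a.
have [k [t [d btd]]] := spectral_exists b; have [_ ->] := btd.
rewrite jmul_suml big1// => i _; rewrite jmul_sumr big1// => j _.
have [si0|si0] := eqVneq (s i) 0; first by rewrite si0 sqrtr0 scale0r jmul0l.
have [->|tj0] := eqVneq (t j) 0; first by rewrite scale0r jmul0r.
by rewrite jmulZl jmulZr (cone_orth_frames aK bK ab asc btd)// !scaler0.
Qed.

Lemma jrank_complementary a b : cone_of_squares a -> cone_of_squares b ->
  jdot a b = 0 ->
  (forall c, jidempotent c -> a ∘ c = 0 -> b ∘ c = 0 -> c = 0) ->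
  (jrank a + jrank b)%N = algebra_rank E.
Proof.
move=> aK bK ab0 ab; apply/eqP; rewrite -(eqr_nat R) natrD -jdot_jone_rank.
have [r [s [c [asc ->]]]] := jrank_spectral a.
have [k [t [d [btd ->]]]] := jrank_spectral b.
have [[cF aE] [dF bE]] := (asc, btd).
(* Each rank is the inner product of the support idempotent with the unit, so it suffices that the
   two supports add up to [jone]. *)
rewrite -(frame_pred_jdot cF) -(frame_pred_jdot dF) -jdotDl.
set p := \sum_(i | _) c i; set q := \sum_(i | _) d i.
have pp : p ∘ p = p := frame_pred_idempotent cF _.
have qq : q ∘ q = q := frame_pred_idempotent dF _.
have cd i j : s i != 0 -> t j != 0 -> c i ∘ d j = 0.
  by move=> *; rewrite (cone_orth_frames aK bK ab0 asc btd).
have pq : p ∘ q = 0.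
  by rewrite jmul_suml big1// => i ?; rewrite jmul_sumr big1// => j ?; rewrite cd.
have ap : a ∘ p = a.
  rewrite /p (frame_sum_pred c) aE (frame_sum_mul cF); apply: eq_bigr => i _ /=.
  by case: eqVneq => [->|]; rewrite ?mul0r// mulr1.
have bq : b ∘ q = b.
  rewrite /q (frame_sum_pred d) bE (frame_sum_mul dF); apply: eq_bigr => i _ /=.
  by case: eqVneq => [->|]; rewrite ?mul0r// mulr1.
have aq : a ∘ q = 0.
  rewrite aE jmul_suml big1// => i _; rewrite jmul_sumr big1// => j tj.
  by rewrite jmulZl; case: (eqVneq (s i) 0) => [->|si]; rewrite ?scale0r ?cd ?scaler0.
have bp : b ∘ p = 0.
  rewrite jmulC bE jmul_sumr big1// => i _; rewrite jmul_suml big1// => j sj.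
  by rewrite jmulZr; case: (eqVneq (t i) 0) => [->|ti]; rewrite ?scale0r ?cd ?scaler0.
have /eqP : jone - (p + q) = 0.
  apply: ab.
  - rewrite /jidempotent !(jmulDl, jmulDr, jmulNl, jmulNr, jmul1, jmulr1).
    by rewrite pp qq [q ∘ p]jmulC pq addr0 add0r subrr addr0.
  - by rewrite jmulDr jmulNr jmulDr jmulr1 ap aq addr0 subrr.
  - by rewrite jmulDr jmulNr jmulDr jmulr1 bp bq add0r subrr.
by rewrite subr_eq0 => /eqP <-.
Qed.

(* With [a - b = sum_i s_i c_i], pairing [a^2 - b^2 = (a - b) ∘ (a + b)] with
   [c_i] gives [s_i <c_i, a + b>], and [|s_i| <= <c_i, a + b>] as [a] and [b]
   lie in the cone. *)
Lemma cone_sqr_dist a b : cone_of_squares a -> cone_of_squares b ->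
  jdot (a - b) (a - b) <= (algebra_rank E)%:R * `|a ∘ a - b ∘ b|.
Proof.
move=> aK bK; have [r [s [c [cF dE]]]] := spectral_exists (a - b).
rewrite -jdot_jone_rank (frame_size cF) {1 2}dE (frame_jdot_sqr cF).
rewrite -[r in r%:R]card_ord mulr_natl -sumr_const; apply: ler_sum => i _.
have sE : jdot (a - b) (c i) = s i by rewrite dE (frame_jdot_sum cF).
apply: le_trans (frame_jdot_le cF i _).
have -> : a ∘ a - b ∘ b = (a - b) ∘ (a + b).
  by rewrite jmulDr !jmulDl !jmulNl [b ∘ a]jmulC addrA subrK.
rewrite jdot_mulr dE (frame_mul_sum cF) jdotZl normrM.
have ac := cone_idempotent_jdot_ge0 aK (frame_idempotent cF i).
have bc := cone_idempotent_jdot_ge0 bK (frame_idempotent cF i).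
rewrite -(real_normK (num_real (s i))) expr2 ler_wpM2l//.
rewrite -sE jdotBl jdotDr !(jdotC (c i)); apply: le_trans (ler_normB _ _) _.
by rewrite !ger0_norm// addr_ge0.
Qed.

(** For [w] with coefficients [s i], the squared inequality says that the sum of the [s i ^+ 4] is
    at most the square of the sum of the [s i ^+ 2]. *)
Lemma norm_jsqr_le w : `|w ∘ w| <= jdot w w.
Proof.
rewrite -ler_sqr ?nnegrE ?jdot_ge0// jnorm_sqr.
have [r [s [c [cF ->]]]] := spectral_exists w.
rewrite (frame_sum_mul cF) !(frame_jdot_sqr cF) expr2 mulr_sumr.
apply: ler_sum => i _; rewrite -!expr2 expr2 ler_wpM2r ?sqr_ge0//.
by rewrite (bigD1 i)//= lerDl sumr_ge0// => j _; rewrite sqr_ge0.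
Qed.

End Trace.

End JordanTheory.

(** * Quadratic forms and second-order expansions *)

Section QuadraticForms.
Context {R : realType} {N : nat}.
Implicit Types (p q : 'rV[R]_N -> R) (u : 'rV[R]_N).

(** Compactness of the unit sphere is applied to these forms, which calls for continuity and
    homogeneity rather than an underlying bilinear form. *)
Definition quadratic q := continuous q /\ forall t u, q (t *: u) = t ^+ 2 * q u.

Lemma quadraticD q p : quadratic q -> quadratic p -> quadratic (fun u => q u + p u).
Proof.
move=> [qc qh] [pc ph]; split=> [u|t u]; last by rewrite qh ph mulrDr.
exact: cvgD (qc u) (pc u).
Qed.

Lemma quadraticZ t q : quadratic q -> quadratic (fun u => t * q u).
Proof.
move=> [qc qh]; split=> [u|s u]; last by rewrite qh mulrCA.
exact: cvgM (cvg_cst t) (qc u).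
Qed.

(** Expanding both arguments in the canonical basis makes [B u u] a polynomial in the coordinates,
    which gives continuity. *)
Lemma biscalar_quadratic (B : 'rV[R]_N -> 'rV[R]_N -> R) :
  (forall u, scalar (B u)) -> (forall u, scalar (B^~ u)) ->
  quadratic (fun u => B u u).
Proof.
move=> Br Bl; pose Lr u := GRing.isLinear.Build R _ R *%R (B u) (Br u).
pose Ll u := GRing.isLinear.Build R _ R *%R (B^~ u) (Bl u).
pose br u : {scalar 'rV[R]_N} := HB.pack (B u) (Lr u).
pose bl u : {scalar 'rV[R]_N} := HB.pack (B^~ u) (Ll u).
have BE : (fun u => B u u) =
    (fun u => \sum_i \sum_j u 0 i * (u 0 j * B 'e_i 'e_j)).
  apply/funext => u; rewrite -[LHS]/(bl u u) {2}(row_sum_delta u) linear_sum.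
  apply: eq_bigr => i _; rewrite linearZ/= -mulr_sumr; congr (_ * _).
  rewrite -[LHS]/(br _ u) {1}(row_sum_delta u) linear_sum.
  by apply: eq_bigr => j _; rewrite linearZ.
split=> [|t u].
  have cc k : continuous (fun u : 'rV[R]_N => u 0 k) by exact: coord_continuous.
  rewrite BE; apply: continuous_big => [|i _]; first exact: add_continuous.
  apply: continuous_big => [|j _ u]; first exact: add_continuous.
  exact: cvgM (cc i u) (cvgM (cc j u) (cvg_cst _)).
rewrite -[LHS]/(bl (t *: u) (t *: u)) linearZ/= -[B u _]/(br u (t *: u)).
by rewrite linearZ/= mulrA expr2.
Qed.

Let sphere := [set u : 'rV[R]_N | `|u| = 1].

Let sphere_compact (A : set 'rV[R]_N) : closed A -> compact (sphere `&` A).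
Proof.
move=> Ac; apply: bounded_closed_compact.
  exists 1; split=> // x x1 u [/= -> _]; exact: ltW.
apply: closedI => //; rewrite (_ : sphere = Num.norm @^-1` [set 1])//.
apply: preimage_closed => [? _|]; [exact: norm_continuous|exact: closed_eq].
Qed.

Let sphere_scale u : u != 0 -> sphere (`|u|^-1 *: u).
Proof.
by move=> u0; rewrite /sphere/= normrZ ger0_norm ?invr_ge0// mulVf// normr_eq0.
Qed.

Let quadratic_sphere q u : quadratic q -> u != 0 ->
  q u = `|u| ^+ 2 * q (`|u|^-1 *: u).
Proof. by move=> [_ qh] u0; rewrite -qh scalerA divff ?scale1r// normr_eq0. Qed.

Let quadratic0 q : quadratic q -> q 0 = 0.
Proof. by move=> [_ qh]; rewrite -(scale0r 0) qh expr0n mul0r. Qed.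

Let sphere_neq0 u : sphere u -> u != 0.
Proof. by apply: contraPneq => ->; rewrite /sphere/= normr0 => /esym/eqP; rewrite oner_eq0. Qed.

(** By homogeneity it is enough to compare on the unit sphere, where [q] has a positive minimum and
    [p] a maximum. *)
Lemma quadratic_dominate q p : quadratic q -> quadratic p ->
  (forall u, u != 0 -> 0 < q u) ->
  exists2 k : R, 0 < k & forall u, k * p u <= q u.
Proof.
move=> qq pq q0.
have [S0|/nonemptyPn S0] := pselect (sphere !=set0); last first.
  (* In dimension zero the sphere is empty and only [u = 0] remains. *)
  exists 1 => // u; have [->|u0] := eqVneq u 0; first by rewrite !quadratic0// mulr0.
  by have /sphere_scale := u0; rewrite S0.
have Sc : compact sphere by rewrite -[sphere]setIT; exact: sphere_compact closedT.
have wc (f : 'rV[R]_N -> R) : continuous f -> {within sphere, continuous f}.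
  exact: continuous_subspaceT.
have [u1 Su1 u1P] := EVT_min_rV S0 Sc (wc _ qq.1).
have [u2 Su2 u2P] := EVT_max_rV S0 Sc (wc _ pq.1).
have m0 : 0 < q u1 by apply/q0/sphere_neq0; rewrite inE in Su1.
have M0 : 0 < `|p u2| + 1 by rewrite ltr_wpDl.
(* The minimum of [q] over a bound for [p]; adding [1] keeps the denominator positive. *)
exists (q u1 / (`|p u2| + 1)) => [|u]; first exact: divr_gt0.
have [->|u0] := eqVneq u 0; first by rewrite !quadratic0// mulr0.
rewrite (quadratic_sphere pq u0) (quadratic_sphere qq u0) mulrCA.
have uS := mem_set (sphere_scale u0).
rewrite ler_wpM2l ?sqr_ge0//; apply: le_trans (u1P _ uS).
rewrite mulrAC ler_pdivrMr// ler_pM2l//; apply: le_trans (u2P _ uS) _.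
by rewrite (le_trans (ler_norm _))// lerDl.
Qed.

(* Finsler's lemma: on the compact set of unit vectors with [q u <= 0] the
   form [p] is bounded away from [0]. *)
Lemma quadratic_penalty q p : quadratic q -> quadratic p ->
  (forall u, 0 <= p u) -> (forall u, u != 0 -> p u = 0 -> 0 < q u) ->
  exists2 C : R, 0 <= C & forall u, u != 0 -> 0 < q u + C * p u.
Proof.
move=> qq pq p0 qp.
pose S := sphere `&` [set u | q u <= 0].
have Sc : compact S.
  apply: sphere_compact; rewrite (_ : [set _ | _] = q @^-1` [set t | t <= 0])//.
  by apply: preimage_closed => [? _|]; [exact: qq.1|exact: closed_le].
have wc (f : 'rV[R]_N -> R) : continuous f -> {within S, continuous f}.
  exact: continuous_subspaceT.
suff [C C0 H] : exists2 C : R, 0 <= C & forall u, sphere u -> 0 < q u + C * p u.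
  exists C => // u u0; rewrite (quadratic_sphere pq u0) (quadratic_sphere qq u0).
  rewrite mulrCA -mulrDr mulr_gt0 ?H ?exprn_gt0 ?normr_gt0//.
  exact: sphere_scale.
have [S0|/nonemptyPn S0] := pselect (S !=set0); last first.
  exists 0 => // u Su; rewrite mul0r addr0 ltNge; apply/negP => qu.
  by have : S u by []; rewrite S0.
have [u1 Su1 u1P] := EVT_min_rV S0 Sc (wc _ qq.1).
have [u2 Su2 u2P] := EVT_min_rV S0 Sc (wc _ pq.1).
have m0 : 0 < p u2.
  move: Su2; rewrite inE => -[/sphere_neq0 u20 qu2]; rewrite lt_def p0 andbT.
  by apply/eqP => pu2; move: (qp _ u20 pu2); rewrite ltNge qu2.
(* On [S] this makes the penalty at least [|q u1| + 1], which outweighs the minimum [q u1] of [q];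
   off [S] the form [q] is already positive. *)
exists ((`|q u1| + 1) / p u2) => [|u Su]; first by rewrite divr_ge0.
have [qu|qu] := leP (q u) 0; last first.
  by rewrite ltr_pwDl// mulr_ge0// divr_ge0.
have uS : u \in S by rewrite inE.
apply: (@lt_le_trans _ _ (q u1 + (`|q u1| + 1))).
  by rewrite addrA ltr_wpDl// -lerBlDl sub0r ler_normr lexx orbT.
by rewrite lerD ?u1P// mulrAC ler_pdivlMr// ler_pM2l ?u2P//.
Qed.

End QuadraticForms.

(** * Norm estimates and the second-order Taylor expansion *)

Section Taylor.
Context {R : realType}.

Lemma differentiable_near_le (V W : normedModType R) (F : V -> W) (x : V) (e : R) :
  differentiable F x -> 0 < e ->
  \forall z \near x, `|F z - F x - 'd F x (z - x)| <= e * `|z - x|.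
Proof.
case=> -[_]; rewrite lim_id// => /eqaddoP dFE /dFE.
by apply: filterS => z; rewrite /= opprD addrA.
Qed.

Lemma dotrC (n : nat) (u v : 'rV[R]_n) : dotr u v = dotr v u.
Proof. by apply: eq_bigr => i _; rewrite mulrC. Qed.

Lemma dotr_scalar (n : nat) (u : 'rV[R]_n) : scalar (dotr u).
Proof.
move=> t v w; rewrite /dotr mulr_sumr -big_split; apply: eq_bigr => i _.
by rewrite !mxE mulrDr mulrCA.
Qed.

Lemma dotr_scalarl (n : nat) (u : 'rV[R]_n) : scalar (fun v => dotr v u).
Proof. by move=> t v w; rewrite dotrC dotr_scalar !(dotrC u). Qed.

Lemma dotrBl (n : nat) (u v w : 'rV[R]_n) : dotr (u - v) w = dotr u w - dotr v w.
Proof. by rewrite -sumrB; apply: eq_bigr => i _; rewrite !mxE mulrBl. Qed.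

Lemma dotrZl (n : nat) t (u v : 'rV[R]_n) : dotr (t *: u) v = t * dotr u v.
Proof. by rewrite /dotr mulr_sumr; apply: eq_bigr => i _; rewrite mxE mulrA. Qed.

Lemma dotr_ge0 (n : nat) (v : 'rV[R]_n) : 0 <= dotr v v.
Proof. by rewrite sumr_ge0// => i _; rewrite -expr2 sqr_ge0. Qed.

Lemma dotr_eq0 (n : nat) (v : 'rV[R]_n) : dotr v v = 0 -> v = 0.
Proof.
move=> /psumr_eq0P v0; apply/rowP => i; rewrite mxE.
have sq_ge0 j : true -> 0 <= v 0 j * v 0 j by rewrite -expr2 sqr_ge0.
have /eqP := v0 sq_ge0 i isT.
by rewrite mulf_eq0 orbb => /eqP.
Qed.

(** The norm is the sup norm, hence the factor [n%:R]. *)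
Lemma ler_norm_dotr (n : nat) (u v : 'rV[R]_n) :
  `|dotr u v| <= n%:R * (`|u| * `|v|).
Proof.
rewrite (le_trans (ler_norm_sum _ _ _))// -[n in n%:R]card_ord mulr_natl -sumr_const.
apply: ler_sum => i _; rewrite normrM ler_pM// [leRHS]/Num.norm/= mx_normrE.
  exact: (le_bigmax _ _ (0, i)).
exact: (le_bigmax _ _ (0, i)).
Qed.

Lemma sqr_norm_le_dotr (n : nat) (v : 'rV[R]_n) : `|v| ^+ 2 <= dotr v v.
Proof.
rewrite [X in X ^+ 2]/Num.norm/= mx_normrE.
rewrite -[leRHS]sqr_sqrtr ?dotr_ge0// ler_sqr ?nnegrE ?sqrtr_ge0//; last first.
  by apply/bigmax_geP; left.
apply: bigmax_le => [|[i j] _]; first exact: sqrtr_ge0.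
rewrite -sqrtr_sqr ler_wsqrtr// ord1 /dotr (bigD1 j)//= -expr2 lerDl.
by rewrite sumr_ge0// => k _; rewrite -expr2 sqr_ge0.
Qed.

(** The mean value theorem is applied on the segment from [x] to [z] to [F] minus its quadratic
    model. The derivative of this difference is the first-order remainder of the gradient at [x],
    paired with [z - x]. *)
Lemma second_order_taylor (n : nat) (F : 'rV[R]_n -> R) (x : 'rV[R]_n) (e : R) :
  (forall z, differentiable F z) -> differentiable (gradient F) x ->
  gradient F x = 0 -> 0 < e ->
  \forall z \near x,
    `|F z - F x - 2^-1 * dotr (hessian F x (z - x)) (z - x)| <= e * dotr (z - x) (z - x).
Proof.
move=> dF dgF g0 e0; have n0 : 0 < n%:R + 1 :> R by rewrite ltr_wpDl.
(* Dividing by [n%:R + 1] absorbs the factor lost in [ler_norm_dotr]. *)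
have := differentiable_near_le dgF (divr_gt0 e0 n0).
rewrite g0 => /nbhs_ballP[d d0 dP].
apply/nbhs_ballP; exists d => //= z; rewrite -ball_normE/= => zd.
set v := z - x; pose H := hessian F x.
have vd : `|v| < d by rewrite distrC.
pose phi s : R := F (x + s *: v) - 2^-1 * s ^+ 2 * dotr (H v) v.
pose dphi s : R := dotr (gradient F (x + s *: v) - H (s *: v)) v.
have dphiP (s : R) : is_derive s (1 : R) phi (dphi s).
  have dl : is_diff s (cst x + *:%R^~ v : R -> 'rV[R]_n) (0 + *:%R^~ v).
    exact: is_diffD.
  have dFl : is_derive s (1 : R) (fun t : R => F (x + t *: v)) ('d F (x + s *: v) v).
    have /differentiableP dFs := dF (x + s *: v).
    have dc := @is_diff_comp _ _ _ _ _ _ _ _ s dl dFs.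
    apply: DeriveDef; first exact/diff_derivable/ex_diff.
    by rewrite deriveE; [rewrite diff_val /= add0r scale1r|exact: ex_diff].
  have -> : phi = (fun t : R => F (x + t *: v)) - (2^-1 * dotr (H v) v) *: (id ^+ 2 : R -> R).
    by apply/funext => t; rewrite !fctE /phi [LHS]/=; congr (_ - _); rewrite mulrAC.
  apply: is_derive_eq.
  rewrite gradientP /dphi dotrBl /H /hessian ['d _ _ (s *: v)]linearZ dotrZl.
  by rewrite /GRing.scale/= expr1; field.
have phic : {within `[0, 1], continuous phi}.
  apply: derivable_within_continuous => s _; exact: ex_derive.
have [c c01] := MVT (@ltr01 R) (fun s _ => dphiP s) phic.
have -> : phi 1 - phi 0 = F z - F x - 2^-1 * dotr (H v) v.
  rewrite /phi scale1r scale0r addr0 expr1n mulr1 expr0n mulr0 mul0r subr0.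
  by rewrite addrAC subrKC.
rewrite subr0 mulr1 => ->.
rewrite in_itv/= in c01; have /andP[c0 c1] := c01.
have cvd : ball x d (x + c *: v).
  rewrite -ball_normE/= opprD addNKr normrN normrZ gtr0_norm//.
  by rewrite (le_lt_trans _ vd)// ler_piMl// ltW.
have := dP _ cvd; rewrite subr0 [x + _]addrC addrK => grad_le.
rewrite (le_trans (ler_norm_dotr _ _))//.
apply: (@le_trans _ _ (n%:R * (e / (n%:R + 1) * `|v| * `|v|))).
  rewrite ler_wpM2l// ler_wpM2r// [x + _]addrC (le_trans grad_le)//.
  by rewrite ler_wpM2l ?divr_ge0 ?(ltW e0) ?(ltW n0)// normrZ gtr0_norm// ler_piMl// ltW.
apply: (@le_trans _ _ (e * `|v| ^+ 2)); last by rewrite ler_wpM2l ?sqr_norm_le_dotr ?ltW.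
rewrite -!mulrA -expr2 mulrCA ler_wpM2l ?(ltW e0)// mulrA ler_piMl ?sqr_ge0//.
by rewrite ler_pdivrMr// mul1r lerDl.
Qed.

End Taylor.

(** * Coercivity of the penalized second-order form *)

Section Coercivity.
Import passmx.
Context {R : realType} {n m : nat} {E : euclideanJordanType R}.

(** Finsler's lemma, with the squared constraint residuals as penalty, gives a positive definite
    form, which then dominates a multiple of the squared norm. *)
Lemma second_order_coercive (H : {linear 'rV[R]_n -> 'rV[R]_n})
    (G : {linear 'rV[R]_n -> E}) (K : {linear 'rV[R]_n -> 'rV[R]_m}) (z la : E) :
  (forall (v : 'rV[R]_n) (w : E), (v, w) != (0, 0) ->
     G v - 2 *: (z ∘ w) = 0 -> K v = 0 ->
     0 < dotr (H v) v + 2 * jdot (w ∘ w) la) ->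
  exists k C : R, [/\ 0 < k, 0 <= C & forall v w,
    k * (dotr v v + jdot w w) <= dotr (H v) v + 2 * jdot (w ∘ w) la +
      C * (jdot (G v - 2 *: (z ∘ w)) (G v - 2 *: (z ∘ w)) + dotr (K v) (K v))].
Proof.
move=> HGK; pose e := vbasis (fullv : {vspace E}); have eb := vbasisP fullv : basis_of _ e.
(* A pair [(v, w)] is encoded as a single row vector, [v] followed by the coordinates of [w] in the
   basis [e], so that the results on quadratic forms apply. *)
pose V (u : 'rV[R]_(n + \dim (fullv : {vspace E}))) : 'rV[R]_n := lsubmx u.
pose W (u : 'rV[R]_(n + \dim (fullv : {vspace E}))) : E := vecof e (rsubmx u).
have VD t u u' : V (t *: u + u') = t *: V u + V u' by rewrite /V linearP.
have WD t u u' : W (t *: u + u') = t *: W u + W u' by rewrite /W !linearP.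
pose A u := G (V u) - 2 *: (z ∘ W u).
have AD t u u' : A (t *: u + u') = t *: A u + A u'.
  rewrite /A VD WD linearP jmulDr jmulZr scalerDr opprD addrACA scalerBr.
  by rewrite !scalerA [2 * t]mulrC.
pose qB u u' := dotr (H (V u)) (V u') + 2 * jdot (W u ∘ W u') la.
have qBq : quadratic (fun u => qB u u).
  apply: biscalar_quadratic => u t a b; rewrite /qB VD WD.
    by rewrite dotr_scalar jmulDr jmulZr jdotDl jdotZl; ring.
  by rewrite linearP dotr_scalarl jmulDl jmulZl jdotDl jdotZl; ring.
pose pB u u' := jdot (A u) (A u') + dotr (K (V u)) (K (V u')).
have pBq : quadratic (fun u => pB u u).
  apply: biscalar_quadratic => u t a b; rewrite /pB VD AD [K (_ + _)]linearP.
    by rewrite dotr_scalar jdotDr jdotZr; ring.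
  by rewrite dotr_scalarl jdotDl jdotZl; ring.
pose nB u u' := dotr (V u) (V u') + jdot (W u) (W u').
have nBq : quadratic (fun u => nB u u).
  apply: biscalar_quadratic => u t a b; rewrite /nB VD WD.
    by rewrite dotr_scalar jdotDr jdotZr; ring.
  by rewrite dotr_scalarl jdotDl jdotZl; ring.
have pB0 u : 0 <= pB u u by rewrite addr_ge0 ?jdot_ge0// dotr_ge0.
have qB0 u : u != 0 -> pB u u = 0 -> 0 < qB u u.
  move=> u0 /eqP; rewrite paddr_eq0 ?jdot_ge0 ?dotr_ge0// => /andP[/eqP/jdot_eq0 Au].
  move=> /eqP/dotr_eq0 Ku; apply: HGK => //; apply: contra_neq u0 => -[Vu /eqP].
  rewrite vecof_eq0// => /eqP Wu.
  by rewrite -[u]hsubmxK -/(V u) Vu Wu row_mx0.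
have [C C0 qp0] := quadratic_penalty qBq pBq pB0 qB0.
have [k k0 kP] := quadratic_dominate (quadraticD qBq (quadraticZ C pBq)) nBq qp0.
exists k, C; split=> // v w.
have := kP (row_mx v (rVof e w)).
by rewrite /nB /qB /pB /A /V /W row_mxKl row_mxKr rVofK.
Qed.

End Coercivity.

(** * Optimality conditions *)

Section Lagrangian.
Context {R : realType} {n : nat}.

(** The bound makes the functional [l] continuous, hence its own derivative, and the chain rule
    applies. It serves for the pairings with [mu] and [la]. *)
Lemma is_diff_scalar_comp (W : normedModType R) (l : W -> R) (M : R)
    (F : 'rV[R]_n -> W) (x : 'rV[R]_n) : scalar l -> (forall w, `|l w| <= M * `|w|) ->
  differentiable F x -> is_diff x (l \o F) (l \o 'd F x).
Proof.
move=> ls lM /differentiableP dF.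
pose L := GRing.isLinear.Build R W R *%R l ls.
pose l' : {linear W -> R} := HB.pack l L.
have lc : continuous l'.
  apply: bounded_linear_continuous; apply/linear_boundedP.
  exists M; split=> [|r /ltW Mr w]; first exact: num_real.
  by rewrite (le_trans (lM w))// ler_wpM2r.
have dl : is_diff (F x) l' l'.
  by apply: DiffDef; [exact: linear_differentiable|exact: diff_lin].
exact: is_diff_comp dF dl.
Qed.

Lemma differentiable_row (G : 'I_n -> 'rV[R]_n -> R) (x : 'rV[R]_n) :
  (forall i, differentiable (G i) x) -> differentiable (fun z => \row_i G i z) x.
Proof.
move=> dG; have -> : (fun z => \row_i G i z) = \sum_i (fun z => G i z *: 'e_i).
  apply/funext => z; rewrite fct_sumE [LHS]row_sum_delta.
  by apply: eq_bigr => i _; rewrite mxE.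
by apply: differentiable_sum => i; exact: differentiableZl.
Qed.

End Lagrangian.

Section Optimality.
Context {R : realType} {n m : nat} {E : euclideanJordanType R}.
Hypothesis jdotE : forall y z : E, jdot y z = jtr (y ∘ z).
Variables (f : 'rV[R]_n -> R) (h : 'rV[R]_n -> 'rV[R]_m) (g : 'rV[R]_n -> E).
Hypotheses (f_C2 : C2 f) (h_C2 : C2 h) (g_C2 : C2 g).
Variables (mu : 'rV[R]_m) (la : E).

Let L := lagrangian f h g mu la.

Let dotr_mu_scalar : scalar (fun u => dotr u mu).
Proof. exact: dotr_scalarl. Qed.

Let dotr_mu_le u : `|dotr u mu| <= m%:R * `|mu| * `|u|.
Proof. by rewrite (le_trans (ler_norm_dotr _ _))// -mulrA [`|u| * _]mulrC. Qed.

Let jdot_la_scalar : scalar (fun w : E => jdot w la).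
Proof. by move=> t a b; rewrite jdotDl jdotZl. Qed.

Let jdot_la_le (w : E) : `|jdot w la| <= `|la| * `|w|.
Proof. by rewrite mulrC jdot_le_norm. Qed.

Lemma lagrangian_is_diff z : is_diff z L
  (fun v => 'd f z v - dotr ('d h z v) mu - jdot ('d g z v) la).
Proof.
have df := differentiableP (f_C2.1 z).
have dh := is_diff_scalar_comp dotr_mu_scalar dotr_mu_le (h_C2.1 z).
have dg := is_diff_scalar_comp jdot_la_scalar jdot_la_le (g_C2.1 z).
exact: is_diffB (is_diffB df dh) dg.
Qed.

Lemma lagrangian_diffE z v :
  'd L z v = 'd f z v - dotr ('d h z v) mu - jdot ('d g z v) la.
Proof. by have dL := lagrangian_is_diff z; rewrite diff_val. Qed.

Lemma lagrangian_gradient : gradient L =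
  (fun z => gradient f z - adjoint (@dotr R m) ('d h z) mu
            - adjoint jdot ('d g z) la).
Proof.
apply/funext => z; apply/rowP => i; rewrite !mxE.
exact: lagrangian_diffE.
Qed.

Lemma lagrangian_gradient_differentiable x : differentiable (gradient L) x.
Proof.
apply: (@differentiable_row _ _ (fun i z => 'd L z 'e_i)) => i.
have -> : (fun z => 'd L z 'e_i) = (fun z => 'd f z 'e_i) -
    (fun z => dotr ('d h z 'e_i) mu) - (fun z => jdot ('d g z 'e_i) la).
  by apply/funext => z; exact: lagrangian_diffE.
have df := (f_C2.2 'e_i).1 x.
have [dh _] := is_diff_scalar_comp dotr_mu_scalar dotr_mu_le ((h_C2.2 'e_i).1 x).
have [dg _] := is_diff_scalar_comp jdot_la_scalar jdot_la_le ((g_C2.2 'e_i).1 x).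
exact: differentiableB (differentiableB df dh) dg.
Qed.

Variable x : 'rV[R]_n.
Hypothesis x_KKT : KKT f h g x mu la.
Hypothesis second_order : forall (v : 'rV[R]_n) (w : E), (v, w) != (0, 0) ->
  'd g x v - 2 *: (jsqrt (g x) ∘ w) = 0 -> 'd h x v = 0 ->
  0 < dotr (hessian L x v) v + 2 * jdot (w ∘ w) la.

Lemma KKT_jdot0 : jdot (g x) la = 0.
Proof.
by case: x_KKT => _ _ _ lag _; rewrite -[g x]jmul1 jdot_assoc [g x ∘ la]jmulC lag jdot0r.
Qed.

Lemma KKT_strict_complementarity :
  (jrank (g x) + jrank la)%N = algebra_rank E.
Proof.
have [_ laK gK _ _] := x_KKT.
apply: (jrank_complementary jdotE) => // [|c cc gc lac]; first exact: KKT_jdot0.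
apply/eqP/negPn/negP => c0.
have vw0 : ((0, c) : 'rV[R]_n * E) != (0, 0) by rewrite xpair_eqE negb_and c0 orbT.
have := second_order vw0; rewrite !linear0 cc.
(* The idempotent [c] lies in the cone and is orthogonal to [g x], so [jsqrt (g x)] annihilates it
   and [(0, c)] satisfies the linearized constraints. *)
rewrite (jsqrt_orth jdotE)//; last 2 first.
- exact: jidempotent_cone.
- by rewrite -[g x]jmul1 jdot_assoc gc jdot0r.
rewrite scaler0 subr0 => /(_ erefl erefl).
(* As [la ∘ c = 0], the second-order expression at [(0, c)] is zero, contradicting its
   positivity. *)
rewrite -[c]jmul1 jdot_assoc [c ∘ la]jmulC lac jdot0r mulr0 addr0.
by rewrite /dotr big1 ?ltxx// => i _; rewrite mxE mulr0.
Qed.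

Lemma KKT_local_minimum : local_minimum f h g x.
Proof.
have [gradL laK gK lag hx] := x_KKT.
split=> //.
have gradL0 : gradient L x = 0 by rewrite lagrangian_gradient.
have sla : jsqrt (g x) ∘ la = 0 by rewrite (jsqrt_orth jdotE)// KKT_jdot0.
have [k [C [k0 C0 kP]]] := @second_order_coercive R n m E
  ('d (gradient L) x) ('d g x) ('d h x) _ la second_order.
(* [D] bounds the total coefficient of [e * N] in the final errors: [C * (m%:R + 2)] from the
   penalty and [2] from twice the Taylor remainder. *)
pose D : R := C * (m%:R + 2) + 2.
have D0 : 0 < D by rewrite ltr_wpDl// mulr_ge0// addr_ge0.
pose e : R := Num.min 1 (k / D).
have e0 : 0 < e by rewrite lt_min ltr01 divr_gt0.
have e1 : e <= 1 by rewrite ge_min lexx.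
have eD : e * D <= k by rewrite -ler_pdivlMr// ge_min lexx orbT.
pose r : R := (algebra_rank E)%:R + 1.
have r0 : 0 < r by rewrite ltr_wpDl.
have dL z : differentiable L z by have [] := lagrangian_is_diff z.
have /cvgrPdist_le gc : g z @[z --> x] --> g x.
  exact: differentiable_continuous (g_C2.1 x).
near=> z => -[hz gzK].
have T : `|L z - L x - 2^-1 * dotr (hessian L x (z - x)) (z - x)|
    <= e * dotr (z - x) (z - x).
  near: z; exact: second_order_taylor (lagrangian_gradient_differentiable x) _ _.
have Tg : `|g z - g x - 'd g x (z - x)| <= e * `|z - x|.
  by near: z; exact: differentiable_near_le (g_C2.1 x) _.
have Th : `|h z - h x - 'd h x (z - x)| <= e * `|z - x|.
  by near: z; exact: differentiable_near_le (h_C2.1 x) _.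
(* The radius is chosen so that [cone_sqr_dist] bounds the squared slack displacement [jdot w w] by
   [e ^+ 2]. *)
have gzx : `|g z - g x| <= e ^+ 2 / r.
  rewrite distrC; near: z.
  by apply: gc; rewrite divr_gt0// exprn_gt0.
pose w := jsqrt (g z) - jsqrt (g x).
have {T Tg Th} [v [T Tg Th]] : exists v : 'rV[R]_n,
    [/\ `|L z - L x - 2^-1 * dotr (hessian L x v) v| <= e * dotr v v,
     `|g z - g x - 'd g x v| <= e * `|v| & `|'d h x v| <= e * `|v|].
  by exists (z - x); split=> //; move: Th; rewrite hz hx subrr sub0r normrN.
have ww : jdot w w <= e ^+ 2.
  rewrite (le_trans (cone_sqr_dist jdotE (jsqrt_cone jdotE _) (jsqrt_cone jdotE _)))//.
  rewrite !(jsqrtK jdotE)//; apply: (@le_trans _ _ (r * (e ^+ 2 / r))).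
    by rewrite ler_pM// lerDl.
  by rewrite mulrC divfK// gt_eqF.
have sE : jsqrt (g z) = jsqrt (g x) + w by rewrite addrC subrK.
move: w ww sE => w ww sE.
have gE : g z = g x + 2 *: (jsqrt (g x) ∘ w) + w ∘ w.
  rewrite -[LHS](jsqrtK jdotE gzK) sE jmulDr !jmulDl (jsqrtK jdotE gK).
  by rewrite [w ∘ jsqrt (g x)]jmulC (scaler_nat 2) mulr2n !addrA.
have vv := dotr_ge0 v; have wwge0 := jdot_ge0 w.
have v2 := sqr_norm_le_dotr v; have v0 := normr_ge0 v.
set N := dotr v v + jdot w w.
set Gw := 'd g x v - 2 *: (jsqrt (g x) ∘ w).
(* The residual [Gw] is [w ∘ w] minus the first-order remainder of [g], so its norm is at most
   [jdot w w + e * |v|]. The square of this sum is at most twice the sum of squares, and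
   [jdot w w <= e ^+ 2] removes one factor of the fourth-order term. *)
have pG : jdot Gw Gw <= 2 * e ^+ 2 * N.
  have GwE : Gw = w ∘ w - (g z - g x - 'd g x v).
    rewrite gE (addrC (g x)) (addrAC _ (g x)) addrK opprB addrCA opprD.
    rewrite [X in _ + X]addrCA.
    by rewrite subrr addr0.
  have : `|Gw| <= jdot w w + e * `|v|.
    by rewrite GwE (le_trans (ler_normB _ _))// lerD// (norm_jsqr_le jdotE).
  rewrite -(jnorm_sqr Gw) => Gwle; have Gw0 := normr_ge0 Gw.
  have : `|Gw| ^+ 2 <= (jdot w w + e * `|v|) ^+ 2.
    by rewrite ler_sqr ?nnegrE// addr_ge0// mulr_ge0// ltW.
  have : 0 <= (jdot w w - e * `|v|) ^+ 2 by rewrite sqr_ge0.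
  have : jdot w w * jdot w w <= e ^+ 2 * jdot w w by rewrite ler_wpM2r.
  have : e ^+ 2 * `|v| ^+ 2 <= e ^+ 2 * dotr v v by rewrite ler_wpM2l// sqr_ge0.
  rewrite /N; lra.
have pH : dotr ('d h x v) ('d h x v) <= m%:R * e ^+ 2 * N.
  rewrite (le_trans (ler_norm _))// (le_trans (ler_norm_dotr _ _))// -mulrA.
  rewrite ler_wpM2l// -expr2 (@le_trans _ _ ((e * `|v|) ^+ 2))//.
    by rewrite ler_sqr ?nnegrE// mulr_ge0// ltW.
  by rewrite exprMn ler_wpM2l ?sqr_ge0// (le_trans v2)// lerDl.
(* The cross term dies because [jsqrt (g x)] annihilates [la]. Hence [f z - f x] is
   [L z - L x + jdot (w ∘ w) la], the source of the slack term in the second-order condition. *)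
have zla : jdot (g z) la = jdot (w ∘ w) la.
  rewrite gE !jdotDl jdotZl KKT_jdot0 [jsqrt _ ∘ w]jmulC jdot_assoc sla jdot0r.
  by rewrite mulr0 !add0r.
have LE y : h y = 0 -> L y = f y - jdot (g y) la.
  by move=> hy; rewrite /L /lagrangian hy /dotr big1 ?subr0// => i _; rewrite mxE mul0r.
move: T; rewrite !LE// KKT_jdot0 zla subr0 => /ler_normlP[T _].
(* Twice [f z - f x] is at least [(k - C (2 + m) e^2 - 2 e) N], and [e] was
   chosen so that this is nonnegative. *)
have := kP v w; rewrite -/N -/Gw => kN.
have N0 : 0 <= N by rewrite addr_ge0.
have e2 : e ^+ 2 <= e by rewrite expr2 ler_piMl// ltW.
have pN : C * (jdot Gw Gw + dotr ('d h x v) ('d h x v)) <=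
    C * ((m%:R + 2) * (e * N)).
  rewrite ler_wpM2l//; apply: (@le_trans _ _ ((m%:R + 2) * (e ^+ 2 * N))).
    by rewrite mulrDl addrC lerD// mulrA.
  by rewrite ler_wpM2l ?addr_ge0// ler_wpM2r.
have DN : e * D * N <= k * N by rewrite ler_wpM2r.
have vN : e * dotr v v <= e * N by rewrite ler_wpM2l ?(ltW e0)// lerDl.
rewrite /hessian in T; rewrite /D in DN; lra.
Unshelve. all: by end_near. Qed.

End Optimality.

Theorem proposition6p1 (R : realType) (n m : nat) (E : euclideanJordanType R)
    (jdotE : forall y z : E, jdot y z = jtr (y ∘ z))
    (f : 'rV[R]_n -> R) (h : 'rV[R]_n -> 'rV[R]_m) (g : 'rV[R]_n -> E)
    (f_C2 : C2 f) (h_C2 : C2 h) (g_C2 : C2 g)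
    (x : 'rV[R]_n) (mu : 'rV[R]_m) (la : E) (x_KKT : KKT f h g x mu la)
    (second_order : forall (v : 'rV[R]_n) (w : E), (v, w) != (0, 0) ->
      'd g x v - 2 *: (jsqrt (g x) ∘ w) = 0 -> 'd h x v = 0 ->
      0 < dotr (hessian (lagrangian f h g mu la) x v) v
          + 2 * jdot (w ∘ w) la) :
  [/\ local_minimum f h g x,
      cone_of_squares la &
      (jrank (g x) + jrank la)%N = algebra_rank E].
Proof.
split; last exact: (KKT_strict_complementarity jdotE x_KKT second_order).
  exact: (KKT_local_minimum jdotE f_C2 h_C2 g_C2 x_KKT second_order).
by case: x_KKT.
Qed.
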